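(* There are polynomial-time algorithms for the following two decision problems, each taking as input a temporal graph $(G,\lambda)$ with $G=(V,E)$: (i) does $(G,\lambda)$ admit a strongly temporally transitive orientation of $E$? (ii) does $(G,\lambda)$ admit a strongly strictly temporally transitive orientation of $E$?
   Context: A temporal graph is a pair $(G,\lambda)$ where $G=(V,E)$ is a finite simple undirected graph and $\lambda: E\to\mathbb{N}$ assigns one time-label to each edge. A proper orientation $F$ of $E$ contains exactly one of the two ordered pairs $uv$, $vu$ for each edge $\{u,v\}\in E$; we write $(uv,t)$ for an edge $\{u,v\}$ with label $t$ oriented as $uv$. $F$ is strongly temporally transitive if whenever $(uv,t_1)$ and $(vw,t_2)$ are oriented time-edges with $t_2\ge t_1$, there is an oriented time-edge $(uw,t_3)$ with $t_3>t_2$. $F$ is strongly strictly temporally transitive if whenever $(uv,t_1)$ and $(vw,t_2)$ are oriented time-edges with $t_2> t_1$, there is an oriented time-edge $(uw,t_3)$ with $t_3>t_2$. *)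

(* Defs.v *)
From mathcomp Require Import all_boot all_algebra.
Set Implicit Arguments.
Unset Strict Implicit.
Unset Printing Implicit Defensive.

(** * Random access machines with the logarithmic cost criterion

  The machine model is that of Cook and Reckhow (1973): a finite program acting
  on registers X_0, X_1, ... that hold arbitrary natural numbers and are
  initially 0, with input read sequentially from a read-only tape of natural
  numbers.  Every instruction is charged the binary length of the numbers it
  handles, so that polynomial time agrees with that of Turing machines. *)

Inductive instr : Type :=
| Const of nat & nat         (* Const i a    : X_i <- a *)
| Add of nat & nat & nat     (* Add i j k    : X_i <- X_j + X_k *)
| Sub of nat & nat & nat     (* Sub i j k    : X_i <- X_j - X_k, truncated *)
| LoadInd of nat & nat       (* LoadInd i j  : X_i <- X_(X_j) *)
| StoreInd of nat & nat      (* StoreInd i j : X_(X_i) <- X_j *)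
| JumpPos of nat & nat       (* JumpPos j m  : if X_j > 0, go to line m *)
| Read of nat                (* Read i       : X_i <- next input number *)
| Halt.

Definition program : Type := seq instr.

Record config : Type := Config {
  pc : nat;
  regs : nat -> nat;
  input : seq nat
}.

(* Leaving the program text counts as halting. *)
Definition cur_instr (p : program) (c : config) : instr := nth Halt p (pc c).

Definition halted (p : program) (c : config) : bool :=
  if cur_instr p c is Halt then true else false.

Definition update (X : nat -> nat) (i a : nat) : nat -> nat :=
  fun j => if j == i then a else X j.

(* Reading from an exhausted input tape yields 0. *)
Definition step (p : program) (c : config) : config :=
  let: Config l X s := c in
  match cur_instr p c with
  | Const i a => Config l.+1 (update X i a) s
  | Add i j k => Config l.+1 (update X i (X j + X k)) s
  | Sub i j k => Config l.+1 (update X i (X j - X k)) s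
  | LoadInd i j => Config l.+1 (update X i (X (X j))) s
  | StoreInd i j => Config l.+1 (update X (X i) (X j)) s
  | JumpPos j m => Config (if 0 < X j then m else l.+1) X s
  | Read i => Config l.+1 (update X i (head 0 s)) (behead s)
  | Halt => c
  end.

(* Length of the binary representation, with [bitlen 0 = 1]. *)
Definition bitlen (a : nat) : nat := (trunc_log 2 a).+1.

Definition cost (p : program) (c : config) : nat :=
  let X := regs c in
  match cur_instr p c with
  | Const _ a => bitlen a
  | Add _ j k | Sub _ j k => bitlen (X j) + bitlen (X k)
  | LoadInd _ j => bitlen (X j) + bitlen (X (X j))
  | StoreInd i j => bitlen (X i) + bitlen (X j)
  | JumpPos j _ => bitlen (X j)
  | Read _ => bitlen (head 0 (input c))
  | Halt => 1
  end.

Definition run (p : program) (s : seq nat) (T : nat) : config :=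
  iter T (step p) (Config 0 (fun=> 0) s).

Definition run_time (p : program) (s : seq nat) (T : nat) : nat :=
  \sum_(i < T) cost p (run p s i).

Definition input_size (s : seq nat) : nat := \sum_(a <- s) bitlen a.

(* The answer of a halted machine is yes when X_0 > 0, and no when X_0 = 0. *)
Definition polytime_decidable (I : Type) (enc : I -> seq nat) (P : I -> Prop) :
    Prop :=
  exists (p : program) (q : {poly nat}), forall x : I,
    exists T : nat,
      [/\ halted p (run p (enc x) T),
          run_time p (enc x) T <= (q.[input_size (enc x)])%R
        & (0 < regs (run p (enc x) T) 0) <-> P x].

(** * Temporal graphs and their orientations *)

(* The values of [label] outside [edges] are irrelevant. *)
Record temporal_graph : Type := TemporalGraph {
  nb_vertices : nat;
  edges : {set {set 'I_nb_vertices}};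
  label : {set 'I_nb_vertices} -> nat;
  card_edge : forall e, e \in edges -> #|e| = 2
}.

Notation vertex G := 'I_(nb_vertices G).

Definition proper_orientation (G : temporal_graph)
    (F : {set vertex G * vertex G}) : Prop :=
  (forall u v, (u, v) \in F -> [set u; v] \in edges G) /\
  (forall u v, [set u; v] \in edges G -> ((u, v) \in F) (+) ((v, u) \in F)).

Definition oriented_time_edge (G : temporal_graph)
    (F : {set vertex G * vertex G}) (u v : vertex G) (t : nat) : Prop :=
  (u, v) \in F /\ label [set u; v] = t.

Definition strongly_temporally_transitive (G : temporal_graph)
    (F : {set vertex G * vertex G}) : Prop :=
  forall u v w t1 t2,
    oriented_time_edge F u v t1 -> oriented_time_edge F v w t2 -> t1 <= t2 ->
    exists t3, oriented_time_edge F u w t3 /\ t2 < t3.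

Definition strongly_strictly_temporally_transitive (G : temporal_graph)
    (F : {set vertex G * vertex G}) : Prop :=
  forall u v w t1 t2,
    oriented_time_edge F u v t1 -> oriented_time_edge F v w t2 -> t1 < t2 ->
    exists t3, oriented_time_edge F u w t3 /\ t2 < t3.

(* The number of vertices followed by the labelled adjacency matrix, row by row.
   The entry of an edge with label t is t + 1, as t = 0 is allowed and 0 marks
   a non-edge. *)
Definition encode (G : temporal_graph) : seq nat :=
  nb_vertices G ::
    [seq if [set u; v] \in edges G then (label [set u; v]).+1 else 0
       | u <- enum (vertex G), v <- enum (vertex G)].

(* Main.v *)
Require Import Defs.
From mathcomp Require Import all_boot all_algebra.
From mathcomp Require Import zify.

(** Orienting [uv] is a truth value for the arc [uv], whose negation is the arc [vu].
  A path u, v, w with labels t1 <= t2 (or t1 < t2) forbids choosing both [uv] and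
  [vw] unless [uw] is an edge with a label t3 > t2.  In that last case the
  requirement "[uv] and [vw] imply [uw]" looks ternary, but the path v, w, u, with
  labels t2 < t3, already forbids choosing both [vw] and [wu], so that [vw] alone
  implies [uw].  Both problems are thus instances of 2-satisfiability, and are
  solvable if and only if no arc of an edge both implies and is implied by its
  reversal.  This is decided by closing the implications under transitivity.

  On the machine side, one step lengthens the numbers handled by at most one bit, so
  that T steps cost a polynomial in T and the input size, and it remains to bound the
  number of steps.  In a language whose only loops run through the vertices, that
  bound is a polynomial read off the program. *)
Set Implicit Arguments.
Unset Strict Implicit.
Unset Printing Implicit Defensive.

(** * The cost of a run is polynomial in its length *)

Lemma leq_bitlen a b : a <= b -> bitlen a <= bitlen b.
Proof. by move=> ab; rewrite ltnS leq_trunc_log. Qed.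

Lemma bitlen_double a : bitlen (a + a) <= (bitlen a).+1.
Proof.
by case: a => [|a] //; rewrite addnn /bitlen trunc_log2_double.
Qed.

Lemma bitlen_add a b L : bitlen a <= L -> bitlen b <= L -> bitlen (a + b) <= L.+1.
Proof.
wlog ab : a b / a <= b.
  by move=> H; case: (leqP a b) => [|/ltnW] /H // H' *; rewrite addnC H'.
move=> _ bL; apply: leq_trans (leq_bitlen _) (leq_trans (bitlen_double b) _) => //.
by rewrite leq_add2r.
Qed.

Definition const_size (p : program) : nat :=
  \sum_(i <- p) if i is Const _ a then bitlen a else 0.

Lemma const_size_nth p l i a : nth Halt p l = Const i a -> bitlen a <= const_size p.
Proof.
elim: p l => [|i' p IHp] [|l] //=; rewrite /const_size big_cons.
  by move=> ->; apply: leq_addr.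
by move=> /IHp H; apply: leq_trans H (leq_addl _ _).
Qed.

(** Constants come from the program and read numbers from the input; the successor covers the zeros
    that fill the registers and follow the input. *)
Definition size_bound (p : program) (s : seq nat) : nat :=
  (const_size p + input_size s).+1.

(* An addition lengthens numbers by at most one bit, so that no register gets
   longer than the number of steps taken allows. *)
Lemma run_bitlen p s T :
  (forall j, bitlen (regs (run p s T) j) <= size_bound p s + T) /\
  input_size (input (run p s T)) <= input_size s.
Proof.
elim: T => [|T]; first by split.
rewrite /run iterS -/(run _ _ _); case: (run p s T) => l X t /= [HX Ht].
have upd i a : bitlen a <= size_bound p s + T.+1 ->
    forall j, bitlen (update X i a j) <= size_bound p s + T.+1.
  move=> Ha j; rewrite /update; case: eqP => // _.
  by rewrite addnS; apply: leqW.
have small a : bitlen a <= size_bound p s + T -> bitlen a <= size_bound p s + T.+1.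
  by rewrite addnS; apply: leqW.
case def_i: (cur_instr _ _) => [i a|i j k|i j k|i j|i j|j m|i|] /=;
  split=> //; try by [move=> j1; apply: small | apply: upd; apply: small].
- apply: upd; apply: small; apply: leq_trans (const_size_nth def_i) _.
  by rewrite /size_bound; lia.
- by apply: upd; rewrite addnS; apply: bitlen_add.
- by apply: upd; apply: small; apply: leq_trans (leq_bitlen (leq_subr _ _)) _.
- apply: upd; apply: small; case: t Ht {def_i} => [|a t]; rewrite /input_size ?big_cons /=.
    by rewrite /bitlen trunc_log0 /size_bound; lia.
  by rewrite /size_bound /input_size; lia.
- case: t Ht {def_i} => [|a t]; rewrite /input_size ?big_cons //=.
  by apply: leq_trans; apply: leq_addl.
Qed.

(** An instruction is charged for at most two numbers, each of length at most
    [size_bound p s + T]. *)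
Lemma run_time_le p s T : run_time p s T <= T * (2 * (size_bound p s + T)).
Proof.
rewrite -[T in T * _]card_ord -sum_nat_const; apply: leq_sum => i _.
have [HX Ht] := run_bitlen p s i.
have {}HX j : bitlen (regs (run p s i) j) <= size_bound p s + T.
  by apply: leq_trans (HX j) _; rewrite leq_add2l ltnW.
rewrite /cost mul2n -addnn.
case def_i: (cur_instr _ _) => [j a|j k l|j k l|j k|j k|j m|j|];
  rewrite ?leq_add ?(leq_trans (HX _)) ?leq_addr //.
- apply: leq_trans (const_size_nth def_i) _; rewrite /size_bound; lia.
- case: (input _) Ht => [|a t]; rewrite /input_size ?big_cons /size_bound /=.
    by rewrite /bitlen trunc_log0; lia.
  by rewrite /input_size; lia.
Qed.

(** * Total correctness of machine code, with running times *)

(* Code is a function of the line at which it is placed, as jumps are absolute. *)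
Definition code : Type := nat -> program.

Definition code_at (p : program) (o : nat) (c : program) : Prop :=
  forall i, i < size c -> nth Halt p (o + i) = nth Halt c i.

Lemma code_at_cat p o c1 c2 :
  code_at p o (c1 ++ c2) <-> code_at p o c1 /\ code_at p (o + size c1) c2.
Proof.
split=> [H|[H1 H2] i].
  split=> i Hi.
    by rewrite H ?size_cat ?nth_cat ?Hi // ltn_addr.
  by rewrite -addnA H ?size_cat ?ltn_add2l // nth_cat ltnNge leq_addr /= addKn.
rewrite size_cat nth_cat => lt_i; case: ltnP => Hi; first exact: H1.
by rewrite -H2 ?ltn_subLR // -addnA subnKC.
Qed.

(** Total correctness from one fixed initial state, to which Q may then refer. Control enters at the
    first line of the code, wherever it is placed, and leaves just past its last line. *)
Definition triple (c : code) (X : nat -> nat) (s : seq nat) (t : nat)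
    (Q : (nat -> nat) -> seq nat -> Prop) : Prop :=
  forall p o, code_at p o (c o) ->
  exists k X' s', [/\ k <= t,
    iter k (step p) (Config o X s) = Config (o + size (c o)) X' s' & Q X' s'].

Lemma triple_weaken c X s t t' (Q Q' : (nat -> nat) -> seq nat -> Prop) :
  t <= t' -> (forall X' s', Q X' s' -> Q' X' s') ->
  triple c X s t Q -> triple c X s t' Q'.
Proof.
move=> tt' QQ' H p o /H [k [X' [s' [kt ? /QQ' ?]]]].
by exists k, X', s'; split=> //; apply: leq_trans tt'.
Qed.

Definition seqc (c1 c2 : code) : code :=
  fun o => c1 o ++ c2 (o + size (c1 o)).

Lemma triple_seqc c1 c2 X s t1 t2 Q1 Q2 :
  triple c1 X s t1 Q1 ->
  (forall X' s', Q1 X' s' -> triple c2 X' s' t2 Q2) ->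
  triple (seqc c1 c2) X s (t1 + t2) Q2.
Proof.
move=> H1 H2 p o /code_at_cat [/H1 [k1 [X1 [s1 [k1t E1 HQ1]]]]].
move=> /(H2 _ _ HQ1) [k2 [X2 [s2 [k2t E2 HQ2]]]].
exists (k2 + k1), X2, s2; split=> //; first by rewrite addnC leq_add.
by rewrite iterD E1 E2 size_cat addnA.
Qed.

Definition effect (i : instr) (st : (nat -> nat) * seq nat) :=
  let c := step [:: i] (Config 0 st.1 st.2) in (regs c, input c).

Definition straight (i : instr) : bool :=
  match i with JumpPos _ _ | Halt => false | _ => true end.

Lemma step_straight p l X s i : straight i -> nth Halt p l = i ->
  step p (Config l X s) = Config l.+1 (effect i (X, s)).1 (effect i (X, s)).2.
Proof. by move=> Hi pl; rewrite /step /cur_instr /= pl; case: i Hi {pl}. Qed.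

Lemma triple_straight (l : program) X s Q : all straight l ->
  (let st := foldl (fun st i => effect i st) (X, s) l in Q st.1 st.2) ->
  triple (fun=> l) X s (size l) Q.
Proof.
move=> + HQ p o; elim: l o X s HQ => [|i l IHl] o X s /= HQ.
  by exists 0, X, s; rewrite /= addn0.
case/andP=> Hi Hl Hp.
have Hp' : code_at p o.+1 l by move=> j Hj; rewrite addSnnS Hp.
have [|k [X' [s' [kt E HQ']]]] := IHl o.+1 (effect i (X, s)).1 (effect i (X, s)).2 _ Hl Hp'.
  by rewrite -surjective_pairing.
exists k.+1, X', s'; split=> //.
by rewrite iterSr (step_straight _ _ Hi) ?E ?addSnnS // -[o]addn0 Hp.
Qed.

(* Register [4 * j] is slot j of a stack, the slots from d on being scratch space
   for code generated at depth d; slot 0 holds the number of vertices.  The other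
   registers hold three arrays. *)
Definition slot (j : nat) : nat := 4 * j.

(** The frame condition of code generated at depth d. *)
Definition agree (d : nat) (X X' : nat -> nat) : Prop :=
  forall j, (forall i, d <= i -> j <> slot i) -> X' j = X j.

Lemma agree_trans d X1 X2 X3 : agree d X1 X2 -> agree d X2 X3 -> agree d X1 X3.
Proof. by move=> H1 H2 j Hj; rewrite H2 // H1. Qed.

Lemma agree_leq d d' X X' : d <= d' -> agree d' X X' -> agree d X X'.
Proof. by move=> dd' H j Hj; apply: H => i Hi; apply: Hj; apply: leq_trans Hi. Qed.

Lemma agree_update d X X' i a : d <= i -> agree d X X' ->
  agree d X (update X' (slot i) a).
Proof. by move=> di H j Hj; rewrite /update; case: eqP => [/Hj|_] //; apply: H. Qed.

Lemma agree_slot d X X' i : agree d X X' -> i < d -> X' (slot i) = X (slot i).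
Proof. by move=> H id; apply: H => i' Hi'; rewrite /slot; lia. Qed.

Lemma update_slot X i a j :
  update X (slot i) a (slot j) = if j == i then a else X (slot j).
Proof. by rewrite /update /slot eqn_mul2l. Qed.

(** As the loop test comes after the body, an initial jump must skip the body when n = 0: it tests 1
    - n in slot d+1. The offset 5 counts the lines before the body, and 8 all lines outside it. *)
Definition loopc (d : nat) (body : code) : code := fun o =>
  [:: Const (slot d) 0; Add (slot d) (slot d) (slot 0); Const (slot d.+1) 1;
      Defs.Sub (slot d.+1) (slot d.+1) (slot d);
      JumpPos (slot d.+1) (o + size (body (o + 5)) + 8)]
  ++ body (o + 5)
  ++ [:: Const (slot d.+1) 1; Defs.Sub (slot d) (slot d) (slot d.+1);
         JumpPos (slot d) (o + 5)].

Lemma size_loopc d body o : size (loopc d body o) = size (body (o + 5)) + 8.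
Proof. by rewrite /loopc !size_cat /=; lia. Qed.

Lemma code_at_loopc p o d body : code_at p o (loopc d body o) ->
  [/\ code_at p o [:: Const (slot d) 0; Add (slot d) (slot d) (slot 0);
                      Const (slot d.+1) 1; Defs.Sub (slot d.+1) (slot d.+1) (slot d)],
      nth Halt p (o + 4) = JumpPos (slot d.+1) (o + size (body (o + 5)) + 8),
      code_at p (o + 5) (body (o + 5)),
      code_at p (o + 5 + size (body (o + 5)))
        [:: Const (slot d.+1) 1; Defs.Sub (slot d) (slot d) (slot d.+1)] &
      nth Halt p (o + 5 + size (body (o + 5)) + 2) = JumpPos (slot d) (o + 5)].
Proof.
move=> /code_at_cat [Ha /code_at_cat [Hb Hc]]; split=> //.
- by move=> i /= Hi; rewrite Ha //=; [case: i Hi => [|[|[|[|]]]] | lia].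
- exact: (Ha 4).
- by move=> i /= Hi; rewrite Hc //=; [case: i Hi => [|[|]] | lia].
- exact: (Hc 2).
Qed.

(** P k is the invariant after k passes. It has to survive changes to the slots from d on, because
    the loop control itself writes slots d and d+1, at 3 steps per pass. *)
Lemma triple_loopc d body n t (P : nat -> (nat -> nat) -> seq nat -> Prop) X s :
  0 < d ->
  (forall k X X' s, P k X s -> agree d X X' -> P k X' s) ->
  (forall k X s, P k X s -> X (slot 0) = n) ->
  (forall k X s, k < n -> P k X s -> X (slot d) = n - k ->
     triple body X s t (fun X' s' => P k.+1 X' s' /\ X' (slot d) = n - k)) ->
  P 0 X s ->
  triple (loopc d body) X s (5 + n * (t + 3)) (fun X' s' => P n X' s').
Proof.
move=> d_gt0 Pagree Pn Hbody P0 p o /code_at_loopc [Hinit Hj Hb Hdec Hj'].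
pose start X := [/\ X (slot d) = n, X (slot d.+1) = 1 - n & P 0 X s].
have [||k0 [X0 [s0 [k0t E0 [[Xd Xz {}P0] {}s0s]]]]] :=
  @triple_straight _ X s (fun X' s' => start X' /\ s' = s) _ _ p o Hinit.
- by [].
- rewrite /= /start !update_slot !(eqxx, ltn_eqF (ltnSn d), gtn_eqF (ltnSn d)) (ltn_eqF d_gt0) /=.
  split=> //; split; rewrite ?add0n ?(Pn _ _ _ P0) //.
  by apply: Pagree P0 _; do !apply: agree_update => //.
rewrite s0s {s0 s0s} in E0.
have Ejump : iter (1 + k0) (step p) (Config o X s) =
    Config (if 0 < 1 - n then o + size (body (o + 5)) + 8 else o + 5) X0 s.
  by rewrite iterD E0 /= /step /cur_instr /= Hj Xz -addnS.
(* There are m.+1 passes left, so that the closing jump falls through exactly when m = 0. *)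
have loop m k X1 s1 : n - k = m.+1 -> P k X1 s1 -> X1 (slot d) = n - k ->
    exists k' X' s', [/\ k' <= m.+1 * (t + 3),
      iter k' (step p) (Config (o + 5) X1 s1) =
        Config (o + size (body (o + 5)) + 8) X' s' & P n X' s'].
  elim: m k X1 s1 => [|m IHm] k X1 s1 nk Pk Xk;
    (have [|k1 [X2 [s2 [k1t E1 [P2 X2d]]]]] := Hbody k X1 s1 _ Pk Xk _ _ Hb;
       first lia);
    have [||k2 [X3 [s3 [k2t E2 [[X3d P3] s3s]]]]] :=
      @triple_straight _ X2 s2 (fun X' s' =>
        (X' (slot d) = n - k.+1 /\ P k.+1 X' s') /\ s' = s2) _ _ _ _ Hdec => //.
  - rewrite /= !update_slot !(eqxx, ltn_eqF (ltnSn d)) X2d; split=> //; split; first lia.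
    by apply: Pagree P2 _; do !apply: agree_update => //.
  - exists (1 + (k2 + k1)), X3, s3; split; first by move: k2t => /=; lia.
      rewrite !iterD E1 E2 /= /step /cur_instr /= Hj' X3d s3s.
      by rewrite (_ : n - k.+1 = 0); [congr Config; lia | lia].
    by rewrite (_ : n = k.+1) //; lia.
  - rewrite /= !update_slot !(eqxx, ltn_eqF (ltnSn d)) X2d; split=> //; split; first lia.
    by apply: Pagree P2 _; do !apply: agree_update => //.
  - rewrite {}s3s in E2 P3.
    have [|k3 [X4 [s4 [k3t E3 P4]]]] := IHm k.+1 X3 s2 _ P3 X3d; first lia.
    exists (k3 + (1 + (k2 + k1))), X4, s4; split=> //.
      by move: k2t => /=; lia.
    rewrite !iterD E1 E2 /= -E3; congr (iter _ _ _).
    rewrite /step /cur_instr /= Hj' X3d.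
    by rewrite (_ : 0 < n - k.+1); [congr Config; lia | lia].
have [n0|n_gt0] := posnP n.
  exists (1 + k0), X0, s; split; first by move: k0t => /=; lia.
    by rewrite Ejump n0 size_loopc addnA.
  by rewrite n0.
have [||k1 [X1 [s1 [k1t E1 P1]]]] := loop n.-1 0 X0 s _ P0; rewrite ?subn0 //; first lia.
exists (k1 + (1 + k0)), X1, s1; split=> //.
  by move: k0t k1t; rewrite prednK //=; lia.
by rewrite iterD Ejump (_ : 1 - n = 0) ?E1 ?size_loopc ?addnA //; lia.
Qed.

(** * A structured language whose loops all run n times *)

Inductive array := Label | Reach | Failure.

(** The residue modulo 4 tells the array, so that arrays and slots are disjoint and all
    unbounded. *)
Definition addr (a : array) (i : nat) : nat :=
  4 * i + match a with Label => 1 | Reach => 2 | Failure => 3 end.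

(* [Var i] is the counter of the i-th enclosing loop, counted from the outside. *)
Inductive expr :=
| Num of nat
| Var of nat
| Plus of expr & expr
| Minus of expr & expr
| Scale of expr                (* n times the argument *)
| Get of array & expr.

(** There is no branching: conditions are arithmetic, with positive numbers as true, and the time
    bound depends on n alone. *)
Inductive cmd :=
| Input of array & expr        (* a[e] <- next input number *)
| Store of array & expr & expr
| Seq of cmd & cmd
| For of cmd.

Fixpoint eval (n : nat) (env : seq nat) (m : nat -> nat) (e : expr) : nat :=
  match e with
  | Num a => a
  | Var i => nth 0 env i
  | Plus e1 e2 => eval n env m e1 + eval n env m e2
  | Minus e1 e2 => eval n env m e1 - eval n env m e2
  | Scale e => n * eval n env m e
  | Get a e => m (addr a (eval n env m e))
  end.

Definition store : Type := (nat -> nat) * seq nat.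

Fixpoint exec (n : nat) (env : seq nat) (c : cmd) (st : store) : store :=
  match c with
  | Input a e =>
      (update st.1 (addr a (eval n env st.1 e)) (head 0 st.2), behead st.2)
  | Store a e1 e2 =>
      (update st.1 (addr a (eval n env st.1 e1)) (eval n env st.1 e2), st.2)
  | Seq c1 c2 => exec n env c2 (exec n env c1 st)
  | For c => iteri n (fun k => exec n (rcons env k) c) st
  end.

Fixpoint scoped_expr (k : nat) (e : expr) : bool :=
  match e with
  | Num _ => true
  | Var i => i < k
  | Plus e1 e2 | Minus e1 e2 => scoped_expr k e1 && scoped_expr k e2
  | Scale e | Get _ e => scoped_expr k e
  end.

Fixpoint scoped (k : nat) (c : cmd) : bool :=
  match c with
  | Input _ e => scoped_expr k e
  | Store _ e1 e2 => scoped_expr k e1 && scoped_expr k e2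
  | Seq c1 c2 => scoped k c1 && scoped k c2
  | For c => scoped k.+1 c
  end.

(** * Compilation of the structured language *)

Definition emit (l : program) : code := fun=> l.

(** Two doublings multiply the index by 4. *)
Definition addr_code (d : nat) (a : array) : program :=
  [:: Add (slot d) (slot d) (slot d); Add (slot d) (slot d) (slot d);
      Const (slot d.+1) (addr a 0); Add (slot d) (slot d) (slot d.+1)].

(* The slot of a loop counts down from n, hence the subtraction. *)
Fixpoint compile_expr (d : nat) (e : expr) : code :=
  match e with
  | Num a => emit [:: Const (slot d) a]
  | Var i => emit [:: Defs.Sub (slot d) (slot 0) (slot i.+1)]
  | Plus e1 e2 => seqc (compile_expr d e1) (seqc (compile_expr d.+1 e2)
      (emit [:: Add (slot d) (slot d) (slot d.+1)]))
  | Minus e1 e2 => seqc (compile_expr d e1) (seqc (compile_expr d.+1 e2)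
      (emit [:: Defs.Sub (slot d) (slot d) (slot d.+1)]))
  | Scale e => seqc (compile_expr d.+1 e) (seqc (emit [:: Const (slot d) 0])
      (loopc d.+2 (emit [:: Add (slot d) (slot d) (slot d.+1)])))
  | Get a e => seqc (compile_expr d e)
      (emit (addr_code d a ++ [:: LoadInd (slot d) (slot d)]))
  end.

Fixpoint compile (d : nat) (c : cmd) : code :=
  match c with
  | Input a e => seqc (compile_expr d e)
      (emit (addr_code d a ++ [:: Read (slot d.+1); StoreInd (slot d) (slot d.+1)]))
  | Store a e1 e2 => seqc (compile_expr d e1)
      (seqc (emit (addr_code d a)) (seqc (compile_expr d.+1 e2)
      (emit [:: StoreInd (slot d) (slot d.+1)])))
  | Seq c1 c2 => seqc (compile d c1) (compile d c2)
  | For c => loopc d (compile d.+1 c)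
  end.

(** The indeterminate stands for n; the summands follow the bounds of [triple_seqc] and
    [triple_loopc]. *)
Fixpoint time_expr (e : expr) : {poly nat} :=
  match e with
  | Num _ | Var _ => (1%N)%:P
  | Plus e1 e2 | Minus e1 e2 => time_expr e1 + (time_expr e2 + (1%N)%:P)
  | Scale e => time_expr e + ((1%N)%:P + ((5%N)%:P + 'X * (4%N)%:P))
  | Get _ e => time_expr e + (5%N)%:P
  end%R.

Fixpoint time (c : cmd) : {poly nat} :=
  match c with
  | Input _ e => time_expr e + (6%N)%:P
  | Store _ e1 e2 => time_expr e1 + ((4%N)%:P + (time_expr e2 + (1%N)%:P))
  | Seq c1 c2 => time c1 + time c2
  | For c => (5%N)%:P + 'X * (time c + (3%N)%:P)
  end%R.

Lemma horner_addn (p q : {poly nat}) (n : nat) : (p + q).[n]%R = p.[n]%R + q.[n]%R.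
Proof. exact: hornerD. Qed.

Lemma horner_muln (p q : {poly nat}) (n : nat) : (p * q).[n]%R = p.[n]%R * q.[n]%R.
Proof. exact: hornerM. Qed.

Definition horner_nat := (horner_addn, horner_muln, @hornerX nat, @hornerC nat).

(** The bound [nth 0 env i < n] lets truncated subtraction recover a counter i as n - (n - i). *)
Definition represents (n : nat) (env : seq nat) (m X : nat -> nat) : Prop :=
  [/\ X (slot 0) = n,
      forall i, i < size env -> nth 0 env i < n /\ X (slot i.+1) = n - nth 0 env i
    & forall a i, X (addr a i) = m (addr a i)].

Lemma addr_slot a i j : addr a i <> slot j.
Proof. by rewrite /addr /slot; case: a; lia. Qed.

Lemma addr_eq a i b j : (addr a i == addr b j) = (addr a 0 == addr b 0) && (i == j).
Proof. by rewrite /addr; case: a; case: b => /=; lia. Qed.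

(** Slots 0 to [size env], which hold n and the counters, lie below d, and no array register is a
    slot. *)
Lemma represents_agree n env m X X' d :
  size env < d -> represents n env m X -> agree d X X' -> represents n env m X'.
Proof.
move=> env_d [Xn Xenv Xm] XX'; split=> [|i i_env|a i].
- by rewrite (agree_slot XX') // (leq_ltn_trans _ env_d).
- have [? <-] := Xenv _ i_env; split=> //.
  by rewrite (agree_slot XX') // (leq_ltn_trans _ env_d).
- by rewrite XX' // => j _; apply: addr_slot.
Qed.

Lemma represents_store n env m X a i x : represents n env m X ->
  represents n env (update m (addr a i) x) (update X (addr a i) x).
Proof.
have slotE j : slot j == addr a i = false by apply/eqP => /esym/addr_slot.
move=> [Xn Xenv Xm]; split=> [|j j_env|b j]; rewrite /update ?slotE //.
  exact: Xenv.
by case: eqP.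
Qed.

Lemma addr_codeP d X s a i : X (slot d) = i ->
  let st := foldl (fun st i => effect i st) (X, s) (addr_code d a) in
  [/\ agree d X st.1, st.1 (slot d) = addr a i & st.2 = s].
Proof.
move=> Xd /=; split=> //.
  by do !apply: agree_update => //.
rewrite !update_slot !(eqxx, ltn_eqF (ltnSn d)) Xd /addr; lia.
Qed.

Lemma compile_exprP n env m e d X s :
  size env < d -> scoped_expr (size env) e -> represents n env m X ->
  triple (compile_expr d e) X s (time_expr e).[n]%R (fun X' s' =>
    [/\ s' = s, X' (slot d) = eval n env m e & agree d X X']).
Proof.
elim: e d X s => [a|i|e1 IH1 e2 IH2|e1 IH1 e2 IH2|e IH|a e IH] d X s env_d /= sc_e rX;
  rewrite ?horner_nat.
- apply: triple_straight => //=; rewrite update_slot eqxx; split=> //.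
  exact: agree_update.
- apply: triple_straight => //=; rewrite update_slot eqxx; split=> //.
    case: rX => -> Xenv _; have [lt_in ->] := Xenv _ sc_e; lia.
  exact: agree_update.
- have /andP[sc1 sc2] := sc_e.
  apply: triple_seqc (IH1 d X s env_d sc1 rX) _ => X1 _ [-> X1d XX1].
  have rX1 := represents_agree env_d rX XX1.
  apply: triple_seqc (IH2 _ _ s (leqW env_d) sc2 rX1) _ => X2 _ [-> X2d XX2].
  apply: triple_straight => //=; rewrite update_slot eqxx X2d (agree_slot XX2) // X1d.
  split=> //; apply: agree_update => //; apply: agree_trans XX1 _.
  exact: agree_leq XX2.
- have /andP[sc1 sc2] := sc_e.
  apply: triple_seqc (IH1 d X s env_d sc1 rX) _ => X1 _ [-> X1d XX1].
  have rX1 := represents_agree env_d rX XX1.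
  apply: triple_seqc (IH2 _ _ s (leqW env_d) sc2 rX1) _ => X2 _ [-> X2d XX2].
  apply: triple_straight => //=; rewrite update_slot eqxx X2d (agree_slot XX2) // X1d.
  split=> //; apply: agree_update => //; apply: agree_trans XX1 _.
  exact: agree_leq XX2.
- apply: triple_seqc (IH d.+1 X s (leqW env_d) sc_e rX) _ => X1 _ [-> X1d XX1].
  set x := eval _ _ _ _ in X1d *.
  (* Multiplication by n is iterated addition: after k passes slot d holds k * x, while x stays in
     slot d+1. *)
  pose Q k X' (s' : seq nat) :=
    [/\ s' = s, X' (slot d) = k * x, X' (slot d.+1) = x & agree d X X'].
  apply: (@triple_seqc _ _ _ _ 1 _ (Q 0)).
    apply: triple_straight => //=; split=> //.
    + by rewrite update_slot eqxx.
    + by rewrite update_slot gtn_eqF.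
    + by apply: agree_update => //; apply: agree_leq XX1.
  move=> X2 s2 Q2.
  apply: (@triple_weaken _ _ _ (5 + n * (1 + 3)) _ (Q n)); first by lia.
    by move=> X3 s3 [].
  apply: triple_loopc Q2 => // [k X3 X4 s3 [-> X3d X3d1 XX3] X34|k X3 s3|].
  + split=> //; rewrite ?(agree_slot X34) //.
    by apply: agree_trans XX3 _; apply: agree_leq X34; apply: leqW.
  + case=> _ _ _ XX3; rewrite (agree_slot XX3); first by case: rX.
    by apply: leq_ltn_trans env_d.
  + move=> k X3 s3 k_n [-> X3d X3d1 XX3] X3k.
    apply: triple_straight => //=; rewrite /Q /= !update_slot eqxx !gtn_eqF //.
    do !split=> //; first by rewrite X3d X3d1 mulSn addnC.
    exact: agree_update.
- apply: triple_seqc (IH d X s env_d sc_e rX) _ => X1 _ [-> X1d XX1].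
  apply: triple_straight => //=.
  have [XX2 X2d _] := addr_codeP s a X1d.
  move: XX2 X2d; rewrite /=; set X2 := (update _ _ _) => XX2 X2d.
  rewrite update_slot eqxx X2d; split=> //.
    have := represents_agree env_d rX (agree_trans XX1 XX2).
    by case=> _ _ ->.
  by apply: agree_update => //; apply: agree_trans XX2.
Qed.

Lemma compileP n env c d X m s :
  d = (size env).+1 -> scoped (size env) c -> represents n env m X ->
  triple (compile d c) X s (time c).[n]%R (fun X' s' =>
    s' = (exec n env c (m, s)).2 /\ represents n env (exec n env c (m, s)).1 X').
Proof.
move=> -> {d}.
elim: c env X m s => [a e|a e1 e2|c1 IH1 c2 IH2|c IH] env X m s /= sc_c rX;
  rewrite ?horner_nat; set d := (size env).+1.
- apply: triple_seqc (compile_exprP s (ltnSn _) sc_c rX) _ => X1 _ [-> X1d XX1].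
  apply: triple_straight => //=.
  have [XX2 X2d _] := addr_codeP s a X1d.
  move: XX2 X2d; rewrite /=; set X2 := (update _ _ _) => XX2 X2d.
  split=> //; rewrite !update_slot eqxx ltn_eqF // X2d.
  apply: represents_store; apply: (represents_agree (ltnSn (size env)) rX).
  by apply: agree_update => //; apply: agree_trans XX2.
- have /andP[sc1 sc2] := sc_c.
  apply: triple_seqc (compile_exprP s (ltnSn _) sc1 rX) _ => X1 _ [-> X1d XX1].
  pose Q X' (s' : seq nat) :=
    [/\ s' = s, X' (slot d) = addr a (eval n env m e1) & agree d X X'].
  apply: (@triple_seqc _ _ _ _ 4 _ Q).
    apply: triple_straight => //; have [XX2 X2d s2] := addr_codeP s a X1d.
    by split=> //; apply: agree_trans XX2.
  move=> X2 _ [-> X2d XX2]; have rX2 := represents_agree (ltnSn _) rX XX2.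
  apply: triple_seqc (compile_exprP s (leqW (ltnSn _)) sc2 rX2) _ => X3 _ [-> X3d XX3].
  apply: triple_straight => //=; split=> //; rewrite X3d (agree_slot XX3) // X2d.
  apply: represents_store; apply: (represents_agree (ltnSn (size env)) rX2).
  exact: agree_leq XX3.
- have /andP[sc1 sc2] := sc_c.
  apply: triple_seqc (IH1 _ _ _ s sc1 rX) _ => X1 _ [-> rX1].
  by have := IH2 _ _ _ (exec n env c1 (m, s)).2 sc2 rX1; rewrite -surjective_pairing.
- pose st k := iteri k (fun k => exec n (rcons env k) c) (m, s).
  pose P k X' s' := s' = (st k).2 /\ represents n env (st k).1 X'.
  apply: (@triple_loopc d _ n _ P) => //.
  + move=> k X1 X2 s1 [-> rX1] X12; split=> //.
    exact: represents_agree rX1 X12.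
  + by move=> k X1 s1 [_ []].
  + move=> k X1 _ k_n [-> rX1] X1d.
    have rX1' : represents n (rcons env k) (st k).1 X1.
      case: rX1 => ? Xenv ?; split=> // i; rewrite size_rcons nth_rcons ltnS leq_eqVlt.
      case/predU1P=> [->|i_env]; first by rewrite ltnn eqxx.
      by rewrite i_env; apply: Xenv.
    have := IH (rcons env k) X1 (st k).1 (st k).2.
    rewrite size_rcons => /(_ sc_c rX1').
    apply: triple_weaken => // X2 s2; rewrite -surjective_pairing => -[-> rX2].
    (* Representing [rcons env k] means representing [env] and having the counter in slot d
       intact. *)
    case: (rX2) => X2n X2env X2m; split; last first.
      have := X2env (size env); rewrite size_rcons ltnSn nth_rcons ltnn eqxx.
      by case=> // _ ->.
    split=> //; split=> // i i_env; have := X2env i.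
    by rewrite size_rcons nth_rcons i_env ltnS (ltnW i_env); apply.
Qed.

Definition machine (c : cmd) : program :=
  Read (slot 0) :: seqc (compile 1 c)
    (seqc (compile_expr 1 (Minus (Num 1) (Get Failure (Num 0))))
    (emit [:: Const 0 0; Add 0 0 (slot 1)])) 1.

Lemma poly_nat_homo (p : {poly nat}) (a b : nat) : a <= b -> p.[a]%R <= p.[b]%R.
Proof.
move=> ab; elim/poly_ind: p => [|p c IHp]; first by rewrite !horner0.
by rewrite !horner_nat leq_add2r leq_mul.
Qed.

(** The number of steps is polynomial in n; the hypothesis on [head 0 (enc x)] turns this into a
    polynomial in the input size. *)
Lemma polytime_machine (I : Type) (enc : I -> seq nat) (P : I -> Prop) (c : cmd) :
  scoped 0 c ->
  (forall x, head 0 (enc x) <= input_size (enc x)) ->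
  (forall x, (exec (head 0 (enc x)) [::] c (fun=> 0, behead (enc x))).1 (addr Failure 0) = 0
     <-> P x) ->
  polytime_decidable enc P.
Proof.
move=> sc_c size_enc cP; set p := machine c.
pose e := Minus (Num 1) (Get Failure (Num 0)).
(* The 1 is for reading n and the 2 for the closing lines; q is the bound of [run_time_le] with t
   steps. *)
pose t : {poly nat} := ((1%N)%:P + (time c + (time_expr e + (2%N)%:P)))%R.
pose q : {poly nat} := (t * ((2%N)%:P * (((const_size p).+1)%:P + 'X + t)))%R.
exists p, q => x; set n := head 0 (enc x); set s := behead (enc x).
pose X0 := update (fun=> 0) (slot 0) n.
have rX0 : represents n [::] (fun=> 0) X0.
  split=> // a i; rewrite /X0 /update; case: eqP => // /addr_slot [].
set st := exec n [::] c (fun=> 0, s).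
pose Q (X' : nat -> nat) (s' : seq nat) := X' 0 = 1 - st.1 (addr Failure 0).
pose body := seqc (compile 1 c) (seqc (compile_expr 1 e)
  (emit [:: Const 0 0; Add 0 0 (slot 1)])).
have body_triple : triple body X0 s
    ((time c).[n]%R + ((time_expr e).[n]%R + 2)) Q.
  apply: triple_seqc (@compileP n [::] _ _ _ _ s erefl sc_c rX0) _ => X1 s1 [_ rX1].
  apply: triple_seqc (@compile_exprP n [::] _ e _ _ s1 (ltnSn 0) isT rX1) _ => X2 s2 [_ X2d _].
  by apply: triple_straight => //=; rewrite /Q /= /update /= X2d.
have [|k [X1 [s1 [kt E QX1]]]] := body_triple p 1; first by [].
have runE : run p (enc x) k.+1 = Config (size p) X1 s1.
  rewrite /run iterSr -[size p]/(1 + size (body 1)) -E; congr (iter _ _ _).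
exists k.+1; split.
- by rewrite /halted /cur_instr runE nth_default.
- apply: leq_trans (run_time_le _ _ _) _.
  have T_le : k.+1 <= t.[input_size (enc x)]%R.
    apply: leq_trans (poly_nat_homo _ (size_enc x)).
    by move: kt; rewrite /t !horner_nat -/n; lia.
  have qE (r : {poly nat}) a z :
      ((r * ((2%N)%:P * (a%:P + 'X + r))).[z] = r.[z] * (2%N * (a + z + r.[z])))%R.
    by rewrite !horner_nat.
  rewrite /q qE; apply: leq_mul => //; apply: leq_mul => //.
  by apply: leq_add => //; rewrite /size_bound addSn.
- by rewrite runE /= QX1 -cP; rewrite -/n -/s -/st; lia.
Qed.

(** * The 2-satisfiability theorem *)

(** Contraposition of a path: reverse it and negate its vertices. *)
Lemma connect_skew (T : finType) (neg : T -> T) (e : rel T) :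
  involutive neg -> (forall x y, e x y -> e (neg y) (neg x)) ->
  forall x y, connect e x y -> connect e (neg y) (neg x).
Proof.
move=> negK skew x y /connectP[p]; elim: p x => [|z p IHp] x /=.
  by move=> _ ->; apply: connect0.
case/andP=> xz pz yz; apply: connect_trans (IHp z pz yz) _.
exact/connect1/skew.
Qed.

(* A maximal closed consistent set of literals is complete: it could otherwise be
   extended by everything that an undecided literal implies. *)
Lemma two_sat (T : finType) (neg : T -> T) (e : rel T) :
  involutive neg -> (forall x y, e x y -> e (neg y) (neg x)) ->
  exists F : {set T}, [/\ forall x y, x \in F -> e x y -> y \in F,
    forall x, x \in F -> neg x \notin F &
    forall x, ~~ (connect e x (neg x) && connect e (neg x) x) ->
      (x \in F) || (neg x \in F)].
Proof.
move=> negK skew; have cskew := connect_skew negK skew.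
pose ok (F : {set T}) := [forall x in F,
  (neg x \notin F) && [forall y, connect e x y ==> (y \in F)]].
have okP (F : {set T}) : reflect (forall x, x \in F ->
    neg x \notin F /\ forall y, connect e x y -> y \in F) (ok F).
  apply: (iffP forall_inP) => H x /H.
    by case/andP=> ? /forallP Hc; split=> // y; apply/implyP.
  by case=> -> Hc; apply/forallP => y; apply/implyP/Hc.
have [|F /maxsetP[/okP okF maxF] _] := @maxset_exists _ ok set0.
  by apply/okP => x; rewrite inE.
exists F; split=> [x y /okF[_ Hc] /connect1/Hc //|x /okF[] //|].
have extend x : ~~ connect e x (neg x) -> (x \in F) || (neg x \in F).
  move=> xNx; apply/negPn/negP; rewrite negb_or => /andP[xF nxF].
  case/negP: xF; rewrite -(maxF (F :|: [set y | connect e x y])).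
  - by rewrite !inE connect0 orbT.
  (* A clash is excluded by contraposition: if one of y, [neg y] is in F and x implies the other,
     then F contains [neg x]; if x implies both, then x implies [neg y], which implies [neg x]. *)
  - apply/okP => y; rewrite !inE => /orP[yF|xy].
    + have [nyF Hc] := okF y yF; rewrite (negPf nyF) /=; split=> [|z yz]; last by rewrite inE Hc.
      apply: contra nxF => xny; apply: Hc.
      by rewrite -[y]negK; apply: cskew.
    + split=> [|z yz]; last by rewrite !inE (connect_trans xy yz) orbT.
      rewrite negb_or; apply/andP; split.
        apply: contra nxF => nyF; apply: (okF _ nyF).2; exact: cskew.
      apply: contra xNx => xny; apply: connect_trans xny _; exact: cskew.
  - exact: subsetUl.
(* In the second case the extension is by the consequences of [neg x]. *)
move=> x; rewrite negb_and => /orP[/extend //|nxx].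
by rewrite orbC -[X in _ || (X \in F)]negK extend // negK.
Qed.

(** * The decision program *)

Definition pair_index (e1 e2 : expr) : expr := Plus (Scale e1) e2.

(* The minimum, which is positive if and only if both arguments are. *)
Definition Both (e1 e2 : expr) : expr := Minus e1 (Minus e1 e2).

Definition Leq (e1 e2 : expr) : expr := Minus (Num 1) (Minus e1 e2).

Definition label_of (u v : nat) : expr := Get Label (pair_index (Var u) (Var v)).

(** Stored labels are shifted by one, with 0 for non-edges. The last comparison therefore covers
    both a missing edge uw and one whose label is too small; adding [strict] turns [<=] into [<]. *)
Definition conflict_expr (strict : bool) (u v w : nat) : expr :=
  Both (label_of u v) (Both (label_of v w)
    (Both (Leq (Plus (label_of u v) (Num strict)) (label_of v w))
          (Leq (label_of u w) (label_of v w)))).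

(** Base n digits: [Reach] is a matrix indexed by pairs of arcs ab, uv. *)
Definition reach_index (a b u v : nat) : expr :=
  pair_index (pair_index (pair_index (Var a) (Var b)) (Var u)) (Var v).

Definition read_labels : cmd :=
  For (For (Input Label (pair_index (Var 0) (Var 1)))).

Definition init_reach : cmd := For (For (Store Reach (reach_index 0 1 0 1) (Num 1))).

(* [i] and [j] are positions in [Reach], with equal sources: when c > 0, the target
   at i implies the target at j. *)
Definition imply (c i j : expr) : cmd :=
  Store Reach j (Plus (Get Reach j) (Both c (Get Reach i))).

(** A conflict on the path u, v, w yields two contrapositive implications: uv implies wv, and vw
    implies vu. Variables 2 and 3 are the source arc. *)
Definition relax (strict : bool) : cmd :=
  let c := conflict_expr strict 4 5 6 in
  Seq (imply c (reach_index 2 3 4 5) (reach_index 2 3 6 5))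
      (imply c (reach_index 2 3 5 6) (reach_index 2 3 5 4)).

(** The two outer loops only count n * n rounds; the next two range over source arcs and the inner
    three over paths u, v, w. *)
Definition close_reach (strict : bool) : cmd :=
  For (For (For (For (For (For (For (relax strict))))))).

Definition find_failure : cmd :=
  For (For (Store Failure (Num 0) (Plus (Get Failure (Num 0))
    (Both (label_of 0 1)
      (Both (Get Reach (reach_index 0 1 1 0)) (Get Reach (reach_index 1 0 0 1))))))).

Definition decide (strict : bool) : cmd :=
  Seq read_labels (Seq init_reach (Seq (close_reach strict) find_failure)).

Lemma update_addr m a i x b j :
  update m (addr a i) x (addr b j) =
    if (addr a 0 == addr b 0) && (i == j) then x else m (addr b j).
Proof. by rewrite /update eq_sym addr_eq. Qed.

Lemma pair_index_inj n a b a' b' : b < n -> b' < n ->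
  (n * a + b == n * a' + b') = (a == a') && (b == b').
Proof.
move=> bn b'n; apply/eqP/andP=> [E|[/eqP-> /eqP->] //].
have := congr1 (modn^~ n) E; have := congr1 (divn^~ n) E.
rewrite ![n * _]mulnC !modnMDl !modn_small // !divnMDl ?(leq_ltn_trans _ bn) //.
by rewrite !divn_small // !addn0 => -> ->.
Qed.

Lemma both_gt0 a b : (0 < a - (a - b)) = (0 < a) && (0 < b).
Proof. lia. Qed.

Lemma leq_gt0 a b : (0 < 1 - (a - b)) = (a <= b).
Proof. lia. Qed.

Lemma iteri_ord (S : Type) n (f : nat -> S -> S) (P : nat -> S -> Prop) st :
  P 0 st -> (forall (k : 'I_n) st, P k st -> P k.+1 (f k st)) ->
  P n (iteri n f st).
Proof.
move=> P0 Pf; suff: forall j, j <= n -> P j (iteri j f st) by apply.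
by elim=> [|j IHj] //= j_n; apply: (Pf (Ordinal j_n)); apply: IHj (ltnW j_n).
Qed.

(** The number n * u + v of passes completed before (u, v) is also the row-major position of that
    entry. *)
Lemma exec_for2 n (env : seq nat) c (P : nat -> store -> Prop) st :
  P 0 st ->
  (forall (u v : 'I_n) st, P (n * u + v) st ->
     P (n * u + v).+1 (exec n (rcons (rcons env (u : nat)) (v : nat)) c st)) ->
  P (n * n) (exec n env (For (For c)) st).
Proof.
move=> P0 Pc; apply: (iteri_ord (P := fun k => P (n * k))) => [|u st1 P1].
  by rewrite muln0.
rewrite mulnS addnC.
apply: (iteri_ord (P := fun k => P (n * u + k))) => [|v st2 P2]; first by rewrite addn0.
by rewrite addnS; apply: Pc.
Qed.

Lemma nth_flatten_const (T : Type) (x0 : T) (ss : seq (seq T)) k i j :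
  all (fun s => size s == k) ss -> j < k ->
  nth x0 (flatten ss) (k * i + j) = nth x0 (nth [::] ss i) j.
Proof.
move=> + j_k; elim: ss i => [|s ss IHss] [|i] /=; rewrite ?nth_nil //.
  by case/andP=> /eqP s_k _; rewrite muln0 nth_cat s_k j_k.
case/andP=> /eqP s_k /IHss <-; rewrite nth_cat s_k mulnS -addnA ltnNge leq_addr.
by rewrite addKn.
Qed.

(** * Correctness of the decision program *)

Section Decide.

Variables (n : nat) (lab : 'I_n -> 'I_n -> nat) (strict : bool).

Definition arc : finType := ('I_n * 'I_n)%type.

Definition reversal (x : arc) : arc := (x.2, x.1).

Definition conflict (u v w : 'I_n) : bool :=
  [&& 0 < lab u v, 0 < lab v w, lab u v + strict <= lab v w & lab u w <= lab v w].

Definition follows (x y : arc) : bool := (x.2 == y.1) && conflict x.1 x.2 y.2.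

(** Choosing x excludes every arc in conflict with it, whether that arc comes after or before x on
    the path, and so forces its reversal. *)
Definition implies (x y : arc) : bool := follows x (reversal y) || follows (reversal y) x.

Definition contradictory (x : arc) : bool :=
  connect implies x (reversal x) && connect implies (reversal x) x.

Definition stores_labels (m : nat -> nat) : Prop :=
  forall u v : 'I_n, m (addr Label (n * u + v)) = lab u v.

Definition reach_position (x y : arc) : nat :=
  n * (n * (n * x.1 + x.2) + y.1) + y.2.

Arguments reach_position : simpl never.

Definition reached (m : nat -> nat) (x y : arc) : bool :=
  0 < m (addr Reach (reach_position x y)).

Lemma reached_update m x y a x' y' :
  reached (update m (addr Reach (reach_position x y)) a) x' y' =
    if (x == x') && (y == y') then 0 < a else reached m x' y'.
Proof.
rewrite /reached update_addr /= /reach_position; case: x y x' y' => x1 x2 [y1 y2] [x1' x2'] [y1' y2'].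
by rewrite !pair_index_inj //= !val_eqE !xpair_eqE -!andbA; case: ifP.
Qed.

Lemma read_labelsP st :
  st = (fun=> 0, [seq lab u v | u <- enum 'I_n, v <- enum 'I_n]) ->
  let m := (exec n [::] read_labels st).1 in
  [/\ stores_labels m, forall x y, ~~ reached m x y & m (addr Failure 0) = 0].
Proof.
set s := [seq _ | _ <- _, _ <- _] => ->.
pose P k (st : store) := [/\ forall i, i < k -> st.1 (addr Label i) = nth 0 s i,
  st.2 = drop k s, forall x y, ~~ reached st.1 x y & st.1 (addr Failure 0) = 0].
have [||Hm _ Hr Hf] := @exec_for2 n [::] (Input Label (pair_index (Var 0) (Var 1)))
  P (fun=> 0, s).
- by split=> //; rewrite drop0.
- move=> u v [m t] /= [/= Hm -> Hr Hf]; split=> [i||x y|] /=.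
  + rewrite update_addr ltnS leq_eqVlt => /predU1P[->|i_uv].
      by rewrite !eqxx -nth0 nth_drop addn0.
    by rewrite (gtn_eqF i_uv) andbF Hm.
  + by rewrite -drop1 drop_drop add1n.
  + by rewrite /reached update_addr; apply: Hr.
  + by rewrite update_addr.
split=> // u v; rewrite Hm ?/s.
  rewrite nth_flatten_const //; last by apply/allP => _ /mapP[x _ ->]; rewrite size_map size_enum_ord.
  rewrite (nth_map u) ?size_enum_ord // (nth_map v) ?size_enum_ord //.
  by rewrite !nth_ord_enum.
by have := ltn_ord u; have := ltn_ord v; nia.
Qed.

Lemma init_reachP st :
  stores_labels st.1 -> (forall x y, ~~ reached st.1 x y) -> st.1 (addr Failure 0) = 0 ->
  let m := (exec n [::] init_reach st).1 in
  [/\ stores_labels m, forall x y, reached m x y = (x == y) & m (addr Failure 0) = 0].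
Proof.
move=> Hl Hr Hf.
pose P k (st : store) := [/\ stores_labels st.1,
  forall x y, reached st.1 x y = (x == y) && (n * x.1 + x.2 < k)
  & st.1 (addr Failure 0) = 0].
have [||Hl' Hr' Hf'] := @exec_for2 n [::] (Store Reach (reach_index 0 1 0 1) (Num 1)) P st.
- by split=> // x y; rewrite ltn0 andbF; apply/negbTE.
- move=> u v [m t] [/= Hl1 Hr1 Hf1].
  split=> [u' v'|x y|] /=; [by rewrite update_addr; apply: Hl1 | | by rewrite update_addr].
  rewrite -/(reach_position (u, v) (u, v)) reached_update Hr1.
  have -> : (n * x.1 + x.2 < (n * u + v).+1) =
      (x == (u, v)) || (n * x.1 + x.2 < n * u + v).
    by case: x => x1 x2 /=; rewrite ltnS leq_eqVlt pair_index_inj.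
  rewrite eq_sym; case: eqP => [->|_] //=.
  by rewrite [(u, v) == y]eq_sym; case: eqP.
split=> // x y; rewrite Hr'; case: x => x1 x2 /=; case: eqP => //= _.
by have := ltn_ord x1; have := ltn_ord x2; nia.
Qed.

Definition sound (st : store) : Prop :=
  [/\ stores_labels st.1, st.1 (addr Failure 0) = 0
    & forall x y, reached st.1 x y -> connect implies x y].

(* Soundness and growth are part of the specification, so that what one pass of a
   loop derives still holds, and is still known to be sound, at the end of the loop. *)
Definition ensures (f : store -> store) (G : arc * arc -> arc * arc -> Prop) : Prop :=
  forall st, sound st ->
  [/\ sound (f st),
      forall x y, reached st.1 x y -> reached (f st).1 x y
    & forall p q, G p q -> reached st.1 p.1 p.2 -> reached (f st).1 q.1 q.2].

Lemma ensures_for env c (G : 'I_n -> arc * arc -> arc * arc -> Prop) :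
  (forall k : 'I_n, ensures (exec n (rcons env (k : nat)) c) (G k)) ->
  ensures (exec n env (For c)) (fun p q => exists k, G k p q).
Proof.
move=> fG st sound_st.
pose P k st' := [/\ sound st',
  forall x y, reached st.1 x y -> reached st'.1 x y
  & forall p q (j : 'I_n), j < k -> G j p q -> reached st.1 p.1 p.2 -> reached st'.1 q.1 q.2].
have [||? ? HG] := @iteri_ord _ n (fun k => exec n (rcons env k) c) P st; last first.
- by split=> // p q [k Gk]; apply: HG Gk.
- move=> k st' [sound' mono' HG']; have [sound2 mono2 HG2] := fG k _ sound'.
  split=> // [x y /mono'/mono2 //|p q j].
  rewrite ltnS leq_eqVlt => /predU1P[/val_inj -> Gk /mono'|]; first exact: HG2.
  by move=> jk Gj /(HG' _ _ _ jk Gj)/mono2.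
- by split.
Qed.

Lemma ensures_comp f g G G' :
  ensures f G -> ensures g G' -> ensures (g \o f) (fun p q => G p q \/ G' p q).
Proof.
move=> fG gG' st /fG[sound1 mono1 HG] /=; have [sound2 mono2 HG'] := gG' _ sound1.
split=> // [x y /mono1/mono2 //|p q [/HG pq /pq /mono2 //|/HG' pq /mono1 /pq //]].
Qed.

(** The entry at j is only added to, which gives growth; soundness composes a derived implication
    with the edge from y to z. *)
Lemma implyP env c i j x y z (b : bool) :
  (forall m, eval n env m i = reach_position x y) ->
  (forall m, eval n env m j = reach_position x z) ->
  (forall m, stores_labels m -> (0 < eval n env m c) = b) ->
  (b -> implies y z) ->
  ensures (exec n env (imply c i j)) (fun p q => [/\ b, p = (x, y) & q = (x, z)]).
Proof.
move=> Ei Ej Ec b_yz [m t] [/= Hl Hf Hr]; rewrite Ei Ej.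
set a := _ + _; have a_gt0 : 0 < a = reached m x z || b && reached m x y.
  by rewrite /a addn_gt0 both_gt0 Ec.
split=> /= [|x' y' xy'|_ _ [b_true -> ->] /= xy].
- split=> [u v||x' y'] /=; [by rewrite update_addr; apply: Hl | by rewrite update_addr |].
  rewrite reached_update; case: ifP => [/andP[/eqP <- /eqP <-]|_ /Hr //].
  rewrite a_gt0 => /orP[/Hr //|/andP[/b_yz yz /Hr xy]].
  exact: connect_trans xy (connect1 yz).
- by rewrite reached_update; case: ifP => // /andP[/eqP xx' /eqP zy']; rewrite a_gt0 xx' zy' xy'.
- by rewrite reached_update !eqxx a_gt0 b_true xy orbT.
Qed.

Lemma relaxP r1 r2 (a b u v w : 'I_n) :
  ensures (exec n [:: r1; r2; a : nat; b : nat; u : nat; v : nat; w : nat] (relax strict))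
    (fun p q => [/\ conflict u v w, p = ((a, b), (u, v)) & q = ((a, b), (w, v))] \/
                [/\ conflict u v w, p = ((a, b), (v, w)) & q = ((a, b), (v, u))]).
Proof.
set env := [:: _, _ & _]; set c := conflict_expr strict 4 5 6.
have Ec m : stores_labels m -> (0 < eval n env m c) = conflict u v w.
  by move=> Hl; rewrite /= !both_gt0 !leq_gt0 !Hl.
apply: (@ensures_comp _ _ _ _
  (@implyP env c (reach_index 2 3 4 5) (reach_index 2 3 6 5) (a, b) (u, v) (w, v)
     _ (fun=> erefl) (fun=> erefl) Ec _)
  (@implyP env c (reach_index 2 3 5 6) (reach_index 2 3 5 4) (a, b) (v, w) (v, u)
     _ (fun=> erefl) (fun=> erefl) Ec _)) => conf;
  by rewrite /implies /follows /= eqxx conf ?orbT.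
Qed.

Lemma close_roundP r1 r2 :
  ensures (exec n [:: r1; r2] (For (For (For (For (For (relax strict)))))))
    (fun p q => exists a b u v w,
      [/\ conflict u v w, p = ((a, b), (u, v)) & q = ((a, b), (w, v))] \/
      [/\ conflict u v w, p = ((a, b), (v, w)) & q = ((a, b), (v, u))]).
Proof.
do 5![apply: ensures_for => ?]; exact: relaxP.
Qed.

Lemma close_reachP st :
  stores_labels st.1 -> (forall x y, reached st.1 x y = (x == y)) ->
  st.1 (addr Failure 0) = 0 ->
  let m := (exec n [::] (close_reach strict) st).1 in
  [/\ stores_labels m, forall x y, reached m x y = connect implies x y
    & m (addr Failure 0) = 0].
Proof.
move=> Hl Hr Hf.
(* Each round extends the derived paths by at least one edge, so k rounds cover all paths of length
   at most k. *)
pose P k (st : store) := sound st /\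
  forall x p, path implies x p -> size p <= k -> reached st.1 x (last x p).
have [||[Hl' Hf' Hs] Hc] :=
  @exec_for2 n [::] (For (For (For (For (For (relax strict)))))) P st; last first.
- split=> // x y; apply/idP/idP=> [/Hs //|/connectP[p xp ->]].
  (* A path without repetition among n * n arcs has fewer than n * n edges. *)
  case/shortenP: xp => p' xp' uniq_p' _; apply: Hc => //.
  have := card_uniqP uniq_p' => /= E; have := max_card (mem (x :: p')).
  by rewrite E card_prod card_ord => /ltnW.
- move=> r1 r2 st' [sound' Hc].
  have [sound2 mono2 HG] := close_roundP r1 r2 sound'.
  split=> // x p; case/lastP: p => [|p z].
    by move=> _ _; apply/mono2/(Hc x [::]).
  rewrite rcons_path size_rcons ltnS last_rcons => /andP[xp pz] /(Hc x _ xp).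
  case: (last x p) pz => c d pz; case: x {xp} => a b; case: z pz => c' d' pz.
  apply: (HG (_, (c, d)) (_, (c', d'))).
  case/orP: pz => /andP[/eqP /= E conf]; rewrite E in conf *.
  + by exists a, b, c, d', c'; left.
  + by exists a, b, d', c, d; right.
- split; first by split=> // x y; rewrite Hr => /eqP ->; apply: connect0.
  by move=> x [|//] _ _ /=; rewrite Hr.
Qed.

Lemma find_failureP st :
  stores_labels st.1 -> (forall x y, reached st.1 x y = connect implies x y) ->
  st.1 (addr Failure 0) = 0 ->
  (exec n [::] find_failure st).1 (addr Failure 0) = 0 <->
  forall u v, 0 < lab u v -> ~~ contradictory (u, v).
Proof.
move=> Hl Hr Hf.
pose P k (st' : store) := [/\ stores_labels st'.1,
  forall x y, reached st'.1 x y = connect implies x y &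
  (0 < st'.1 (addr Failure 0)) <-> exists u v : 'I_n,
    [/\ n * u + v < k, 0 < lab u v & contradictory (u, v)]].
have [||_ _ HF] := @exec_for2 n [::] (Store Failure (Num 0) (Plus (Get Failure (Num 0))
    (Both (label_of 0 1)
      (Both (Get Reach (reach_index 0 1 1 0)) (Get Reach (reach_index 1 0 0 1)))))) P st.
- by split=> //; rewrite Hf; split=> // -[u [v []]].
- move=> u v [m t] [/= Hl1 Hr1 HF].
  split=> [u' v'|x y|] /=; rewrite /reached ?update_addr ?eqxx //=; first exact: Hr1.
  rewrite addn_gt0 !both_gt0 Hl1.
  rewrite -/(reach_position (u, v) (v, u)) -/(reach_position (v, u) (u, v)).
  rewrite -!/(reached _ _ _) !Hr1.
  split=> [/orP[/HF[u' [v' [lt_k ? ?]]]|/andP[lab_gt0 bad]]|[u' [v' []]]].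
  + by exists u', v'; split=> //; apply: leqW.
  + by exists u, v.
  + rewrite ltnS leq_eqVlt pair_index_inj // => /orP[|lt_k].
      by move=> /andP[/eqP/val_inj-> /eqP/val_inj->] -> bad; apply/orP; right.
    by move=> ? ?; apply/orP; left; apply/HF; exists u', v'.
split=> [F0 u v lab_gt0|no_bad].
  apply/negP => bad; have : 0 < 0 by rewrite -{2}F0; apply/HF; exists u, v; split=> //;
    have := ltn_ord u; have := ltn_ord v; nia.
  by [].
apply/eqP; rewrite -leqn0 leqNgt; apply/negP => /HF[u [v [_ /no_bad/negP]]].
by [].
Qed.

Lemma exec_decide :
  (exec n [::] (decide strict)
     (fun=> 0, [seq lab u v | u <- enum 'I_n, v <- enum 'I_n])).1 (addr Failure 0) = 0 <->
  forall u v, 0 < lab u v -> ~~ contradictory (u, v).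
Proof.
have [Hl1 Hr1 Hf1] := read_labelsP erefl.
have [Hl2 Hr2 Hf2] := init_reachP Hl1 Hr1 Hf1.
have [Hl3 Hr3 Hf3] := close_reachP Hl2 Hr2 Hf2.
exact: find_failureP.
Qed.

End Decide.

(** * Transitive orientations as truth assignments *)

Lemma reversalK n : involutive (@reversal n).
Proof. by case. Qed.

Lemma implies_skew n (lab : 'I_n -> 'I_n -> nat) strict x y :
  implies lab strict x y -> implies lab strict (reversal y) (reversal x).
Proof. by rewrite /implies !reversalK orbC. Qed.

Lemma connect_closed (T : finType) (e : rel T) (F : {set T}) x y :
  (forall x y, x \in F -> e x y -> y \in F) -> connect e x y -> x \in F -> y \in F.
Proof.
move=> closedF /connectP[p]; elim: p x => [|z p IHp] x /= => [_ -> //|].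
by case/andP=> xz pz yz xF; apply: IHp pz yz _; apply: closedF xz.
Qed.

Section Orientation.

Variables (G : temporal_graph) (strict : bool).

Definition entry (u v : vertex G) : nat :=
  if [set u; v] \in edges G then (label [set u; v]).+1 else 0.

(** Reading [strict] as 0 or 1 treats both notions of transitivity at once. *)
Definition shifted_transitive (F : {set vertex G * vertex G}) : Prop :=
  forall u v w t1 t2,
    oriented_time_edge F u v t1 -> oriented_time_edge F v w t2 -> t1 + strict <= t2 ->
    exists t3, oriented_time_edge F u w t3 /\ t2 < t3.

Lemma entryC u v : entry u v = entry v u.
Proof. by rewrite /entry setUC. Qed.

Lemma entry_gt0 u v : (0 < entry u v) = ([set u; v] \in edges G).
Proof. by rewrite /entry; case: ifP. Qed.

Lemma entry_edge u v : [set u; v] \in edges G -> entry u v = (label [set u; v]).+1.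
Proof. by rewrite /entry => ->. Qed.

Lemma proper_orientation_in F u v : proper_orientation F -> 0 < entry u v ->
  ((u, v) \in F) = ((v, u) \notin F).
Proof. by case=> _ H; rewrite entry_gt0 => /H; case: (_ \in F); case: (_ \in F). Qed.

Lemma orientation_closed F x y : proper_orientation F -> shifted_transitive F ->
  x \in F -> implies entry strict x y -> y \in F.
Proof.
move=> propF transF.
(* Transitivity would provide an arc uw with a label above that of vw, against the last clause of
   [conflict]. *)
have no_conflict (u v w : vertex G) :
    conflict entry strict u v w -> ~ ((u, v) \in F /\ (v, w) \in F).
  case/and4P=> uv vw uvw uw [uvF vwF].
  have [uvE vwE] : [set u; v] \in edges G /\ [set v; w] \in edges G by rewrite -!entry_gt0.
  rewrite !entry_edge // addSn ltnS in uvw.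
  have [||t3 [[uwF <-] lt_t3]] := transF u v w _ _ _ _ uvw; [by split | by split |].
  by move: uw; rewrite !entry_edge ?propF.1 // ltnS leqNgt lt_t3.
case: x y => a b [c d] abF /orP[]/andP[/eqP /= E conf]; subst.
  rewrite (proper_orientation_in propF); last by rewrite entryC; case/and4P: conf.
  by apply/negP => dcF; apply: (no_conflict _ _ _ conf).
rewrite (proper_orientation_in propF); last by rewrite entryC; case/and4P: conf.
by apply/negP => dcF; apply: (no_conflict _ _ _ conf).
Qed.

(* A transitive triangle with labels t1 <= t2 < t3 needs no ternary clause: the
   2-clauses force its edge with label t3 to have the orientation of its edge with
   label t2, that is, [vw] implies [uw]. *)
Lemma conflict_rotate (u v w : vertex G) : 0 < entry u v -> 0 < entry v w ->
  entry u v + strict <= entry v w -> ~~ conflict entry strict u v w ->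
  entry v w < entry u w /\ implies entry strict (v, w) (u, w).
Proof.
rewrite /conflict => uv vw uvw; rewrite uv vw uvw /= -ltnNge => uw; split=> //.
rewrite /implies /follows /conflict /= eqxx vw /=.
by rewrite [entry w u]entryC [entry v u]entryC; case: strict uvw => /=; lia.
Qed.

(** An orientation is closed under implication, so a contradictory edge would have both or neither
    of its arcs. Conversely, [two_sat] decides every arc that is not contradictory, in particular
    both arcs of each edge. *)
Lemma transitive_orientationP :
  (forall u v, 0 < entry u v -> ~~ contradictory entry strict (u, v)) <->
  exists F : {set vertex G * vertex G}, proper_orientation F /\ shifted_transitive F.
Proof.
split=> [consistent|[F [propF transF]] u v uv]; last first.
  have closedF := orientation_closed propF transF.
  apply/negP => /andP[c1 c2].
  move: (connect_closed closedF c1) (connect_closed closedF c2).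
  move: (proper_orientation_in propF uv); rewrite /reversal /=.
  by case: ((u, v) \in F); case: ((v, u) \in F) => // _ H1 H2;
    [have := H1 isT | have := H2 isT].
have [F [closedF consF fullF]] := two_sat (@reversalK _) (@implies_skew _ entry strict).
(* The assignment may also contain arcs of non-edges, which are dropped. *)
pose F' := [set x in F | 0 < entry x.1 x.2].
exists F'; split; first split=> [u v|u v].
- by rewrite inE entry_gt0 => /andP[].
- rewrite -entry_gt0 => uv; rewrite !inE /= [entry v u]entryC uv !andbT.
  have := fullF _ (consistent _ _ uv); have := consF (u, v); rewrite /reversal /=.
  by case: (_ \in F) => [/(_ isT)/negbTE ->|_ /=].
move=> u v w t1 t2 [uvF <-] [vwF <-].
move: uvF vwF; rewrite !inE /= => /andP[uvF uv] /andP[vwF vw].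
rewrite -ltnS -addSn -!entry_edge -?entry_gt0 // => uvw.
have [|uw imp] := conflict_rotate uv vw uvw.
  (* In a conflict, uv would force wv, the reversal of the chosen vw. *)
  apply/negP => conf; have := consF _ vwF; rewrite /reversal /=.
  rewrite (closedF (u, v)) //; by rewrite /implies /follows /= eqxx conf.
exists (label [set u; w]); split.
  by split=> //; rewrite inE /= (closedF _ _ vwF imp) (leq_ltn_trans _ uw).
move: (uw); rewrite !entry_edge -?entry_gt0 ?(leq_ltn_trans _ uw) //.
Qed.

End Orientation.

(** * Polynomial-time decision of the two problems *)

Lemma head_encode (G : temporal_graph) : head 0 (encode G) <= input_size (encode G).
Proof.
rewrite /input_size big_cons /=; apply: leq_trans (leq_addl _ _).
set s := [seq _ | _ <- _, _ <- _]; have sz : size s = nb_vertices G * nb_vertices G.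
  by rewrite size_allpairs !size_enum_ord.
(* The matrix has n * n >= n entries, each of length at least 1. *)
apply: (@leq_trans (size s)); first by rewrite sz; nia.
by rewrite -sum1_size; apply: leq_sum.
Qed.

Lemma polytime_shifted_transitive (strict : bool) :
  polytime_decidable encode (fun G : temporal_graph =>
    exists F : {set vertex G * vertex G}, proper_orientation F /\ shifted_transitive strict F).
Proof.
apply: (@polytime_machine _ _ _ (decide strict)) => // [|G]; first exact: head_encode.
by rewrite -transitive_orientationP; apply: exec_decide.
Qed.

Lemma polytime_decidable_iff (I : Type) (enc : I -> seq nat) (P Q : I -> Prop) :
  (forall x, P x <-> Q x) -> polytime_decidable enc P -> polytime_decidable enc Q.
Proof.
move=> PQ [p [q H]]; exists p, q => x; have [T [? ? TP]] := H x.
exists T; split=> //; apply: iff_trans TP (PQ x).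
Qed.

Theorem theorem3p1 :
  polytime_decidable encode
    (fun G : temporal_graph => exists F : {set vertex G * vertex G},
       proper_orientation F /\ strongly_temporally_transitive F) /\
  polytime_decidable encode
    (fun G : temporal_graph => exists F : {set vertex G * vertex G},
       proper_orientation F /\ strongly_strictly_temporally_transitive F).
Proof.
split; [have := polytime_shifted_transitive false | have := polytime_shifted_transitive true];
  apply: polytime_decidable_iff => G; split=> -[F [propF transF]]; exists F; split=> //
    u v w t1 t2 uv vw t12; apply: (transF _ _ _ _ _ uv vw); move: t12; rewrite ?addn0 ?addn1 //.
Qed.
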